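(* Let $\mathbb F$ be a finite field, $P(x)=p_dx^d+\dots+p_1x+p_0\in\mathbb F[y][x]$ with $d\ge1$ and $p_d,p_0\neq0$, $\mathcal R=\mathbb F[y][x]/(P)$, $X$ the image of $x$, and $\mathcal N=\{q\in\mathbb F[y]:\deg_y(q)<\deg_y(p_0)\}$. Then: (1) $(\mathcal R,X,\mathcal N)$ has the finite expansion property if and only if $\max_{1\le i\le d}\deg_y(p_i)<\deg_y(p_0)$; (2) $(\mathcal R,X,\mathcal N)$ has the periodic expansion property if and only if $\max_{1\le i\le d}\deg_y(p_i)\le\deg_y(p_0)$.
   Context: $\deg_y$ is the degree in $y$, with $\deg_y(0)=-\infty$. For $A\in\mathcal R$, $D_{\mathcal N}(A)$ is the unique $e\in\mathcal N$ with $A-e\in X\mathcal R$, and $T(A)=\frac{A-D_{\mathcal N}(A)}{X}$, the unique $B\in\mathcal R$ with $XB=A-D_{\mathcal N}(A)$. Finite expansion property: for every $A\in\mathcal R$ there is $n\in\mathbb N$ with $T^n(A)=0$. Periodic expansion property: for every $A\in\mathcal R$, $(T^i(A))_{i\ge0}$ is eventually periodic. *)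

(* Defs.v *)
From HB Require Import structures.
From mathcomp Require Import all_boot all_order all_algebra.
From mathcomp Require Import generic_quotient ring_quotient.
From mathcomp Require Import boolp classical_sets.

Set Implicit Arguments.
Unset Strict Implicit.
Unset Printing Implicit Defensive.

Import GRing.Theory.
Local Open Scope ring_scope.
Local Open Scope classical_set_scope.
Local Open Scope quotient_scope.

Section DigitSystem.
Variables (R : comNzRingType) (X : R) (N : set R).

Definition digit_spec (A : R) : set R :=
  [set e | N e /\ exists B, A - e = X * B].

(* [digit] and [shift] are definite descriptions: the default value 0 of
   [xget] is irrelevant as soon as the described element exists and is unique,
   which is proved below for the systems at hand ([digit_ex], [digit_uniq],
   [mulX_inj]). *)
Definition digit (A : R) : R := xget 0 (digit_spec A).

Definition shift (A : R) : R := xget 0 [set B | X * B = A - digit A].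

Definition finite_expansion : Prop :=
  forall A, exists n : nat, iter n shift A = 0.

Definition eventually_periodic (u : nat -> R) : Prop :=
  exists m p : nat, (0 < p)%N /\ forall i, (m <= i)%N -> u (i + p)%N = u i.

Definition periodic_expansion : Prop :=
  forall A, eventually_periodic (fun i => iter i shift A).

End DigitSystem.

Section QuotientRing.
Variables (F : finFieldType) (d : nat) (P : {poly {poly F}}).
Hypotheses (d_ge1 : (1 <= d)%N) (sizeP : size P = d.+1).

(* The hypotheses are arguments of the ideal because the library only puts a
   ring structure on quotients by proper ideals. *)
Definition gen_ideal of (1 <= d)%N & size P = d.+1 : pred {poly {poly F}} :=
  fun A => `[< exists Q, A = Q * P >].

Lemma gen_ideal_closed : idealr_closed (gen_ideal d_ge1 sizeP).
Proof.
split.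
- by apply/asboolP; exists 0; rewrite mul0r.
- apply/asboolP => -[Q eQ].
  have Q0 : Q != 0.
    by apply/eqP => Q0; move/eqP: eQ; rewrite Q0 mul0r oner_eq0.
  have P0 : P != 0 by rewrite -size_poly_gt0 sizeP.
  have := congr1 (fun p : {poly {poly F}} => size p) eQ.
  rewrite size_poly1 size_mul // sizeP addnS /= => /eqP.
  have : (0 < size Q)%N by rewrite size_poly_gt0.
  case: (size Q) => // a _; rewrite addSn eqSS eq_sym addn_eq0 => /andP[_].
  by move/eqP=> d0; move: d_ge1; rewrite d0.
- move=> a u v /asboolP[Qu ->] /asboolP[Qv ->]; apply/asboolP.
  by exists (a * Qu + Qv); rewrite mulrDl mulrA.
Qed.

HB.instance Definition _ :=
  isIdealr.Build {poly {poly F}} (gen_ideal d_ge1 sizeP) gen_ideal_closed.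

Definition gen_idealr : idealr {poly {poly F}} :=
  Idealr.clone {poly {poly F}} (gen_ideal d_ge1 sizeP) _.

Definition quotR : comNzRingType := {ideal_quot gen_idealr}.

Definition quotR_pi (A : {poly {poly F}}) : quotR :=
  \pi_{ideal_quot gen_idealr} A.

Definition quotX : quotR := quotR_pi 'X.

(* [size q] is deg_y q + 1, and 0 for q = 0, so comparing sizes is comparing
   degrees with deg_y 0 = -oo. *)
Definition quotN : set quotR :=
  [set quotR_pi q%:P | q in [set q : {poly F} | (size q < size (P`_0)%R)%N]].

Lemma quotR_piE A B :
  quotR_pi A = quotR_pi B <-> exists Q, A - B = Q * P.
Proof.
split=> [/eqP|H].
  by rewrite -(Quotient.idealrBE gen_idealr) => /asboolP.
apply/eqP; rewrite -(Quotient.idealrBE gen_idealr).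
exact/asboolP.
Qed.

Lemma quotR_piB A B : quotR_pi (A - B) = quotR_pi A - quotR_pi B.
Proof. exact: (rmorphB (\pi_{ideal_quot gen_idealr})). Qed.

Lemma quotR_piM A B : quotR_pi (A * B) = quotR_pi A * quotR_pi B.
Proof. exact: (rmorphM (\pi_{ideal_quot gen_idealr})). Qed.

Lemma quotR_piK (A : quotR) : exists a, A = quotR_pi a.
Proof. by exists (repr A); rewrite /quotR_pi reprK. Qed.

Lemma factorX (a : {poly {poly F}}) : a.[0] = 0 -> exists b, a = b * 'X.
Proof.
move=> /eqP/factor_theorem[b ->]; exists b.
by rewrite polyC0 subr0.
Qed.

Hypothesis p0_neq0 : P`_0 != 0.

Lemma digit_ex A : exists e, digit_spec quotX quotN A e.
Proof.
have [a ->] := quotR_piK A.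
pose r := a`_0 %% P`_0; pose q := a`_0 %/ P`_0.
have [b eb] : exists b, a - r%:P - q%:P * P = b * 'X.
  apply: factorX; rewrite !hornerE !horner_coef0 {1}(divp_eq a`_0 P`_0) -/q -/r.
  by rewrite addrK subrr.
exists (quotR_pi r%:P); split; first by exists r => //=; rewrite ltn_modp.
exists (quotR_pi b); rewrite -quotR_piB /quotX -quotR_piM; apply/quotR_piE.
by exists q%:P; rewrite ['X * b]mulrC -eb opprB addrCA subrr addr0.
Qed.

Lemma digit_uniq A e e' :
  digit_spec quotX quotN A e -> digit_spec quotX quotN A e' -> e = e'.
Proof.
move=> [[q /= sq <-] [B eB]] [[q' /= sq' <-] [B' eB']]; congr (quotR_pi _%:P).
have [[b e1] [b' e2]] := (quotR_piK B, quotR_piK B').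
have : quotR_pi (q%:P - q'%:P) = quotR_pi ('X * (b' - b)).
  rewrite quotR_piM !quotR_piB mulrBr -e1 -e2 -/quotX -eB -eB'.
  by rewrite opprB [RHS]addrC addrA subrK.
move/quotR_piE => [Q /(congr1 (horner^~ 0))].
rewrite !hornerE !horner_coef0 subr0 => eQ.
apply/eqP; rewrite -subr_eq0; apply: contraT => nz.
have : (size (q - q')%R < size (P`_0)%R)%N.
  apply: leq_ltn_trans (size_polyD _ _) _.
  by rewrite size_polyN gtn_max sq sq'.
rewrite ltnNge => /negP[]; apply: dvdp_leq => //.
by rewrite eQ ?dvdp_mull.
Qed.

Lemma mulX_inj : injective ( *%R quotX).
Proof.
move=> B B' /=.
have [[b ->] [b' ->]] := (quotR_piK B, quotR_piK B').
rewrite /quotX -!quotR_piM => /quotR_piE[Q eQ]; apply/quotR_piE.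
have [Q' eQ'] : exists Q', Q = Q' * 'X.
  apply: factorX; move/(congr1 (horner^~ 0)): eQ.
  rewrite !hornerE !horner_coef0 oppr0 => /esym/eqP.
  by rewrite mulf_eq0 (negPf p0_neq0) orbF => /eqP.
exists Q'; apply: (@mulIf _ 'X); first by rewrite polyX_eq0.
by rewrite mulrAC -eQ' -eQ mulrC mulrBr.
Qed.

End QuotientRing.

Arguments quotN {F d P} d_ge1 sizeP.

(* Main.v *)
Require Import Defs.
From mathcomp Require Import all_boot all_order all_algebra.
From mathcomp Require Import classical_sets polyXY zify ring.

Set Implicit Arguments.
Unset Strict Implicit.
Unset Printing Implicit Defensive.

Import GRing.Theory.
Local Open Scope ring_scope.

(** The shift lifts to [F[y][x]] as [a |-> (a - r - q P) / x], where
    [a_0 = q p_0 + r].  If no [p_i] has larger [y]-degree than [p_0], this map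
    increases neither the [y]-degree nor, beyond [d - 1], the [x]-degree, so
    orbits live in a finite set; if the inequalities are strict, the [y]-degree
    drops after finitely many steps.  Conversely, put [k = deg_y p_0] and
    expand [y^k].  A finite expansion reads [y^k = g + Q P] with [deg_y g < k],
    a periodic one gives [(1 - x^p) y^k = g + Q P].  Comparing the leading
    coefficients in [y], which lie in [F[x]], shows that the leading coefficient
    of [P] divides [1], respectively [1 - x^p]; hence it is a nonzero constant,
    respectively has a nonzero constant term. *)

(** * Maxima over a range and eventually periodic orbits *)

Lemma bigmax_nat_leqP (f : nat -> nat) m n b :
  reflect (forall i, (m <= i < n)%N -> (f i <= b)%N)
          (\max_(m <= i < n) f i <= b)%N.
Proof.
apply: (iffP (bigmax_leqP_seq _ _ _ _)) => h i.
  by move=> mi; apply: h => //; rewrite mem_index_iota.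
by rewrite mem_index_iota => mi _; apply: h.
Qed.

(** Only the invariant set [D] has to embed in a finite type, so this applies to a box of
    polynomials inside the infinite polynomial ring. *)
Lemma iter_pigeonhole (T : Type) (U : finType) (f : T -> T) (D : T -> Prop)
    (h : T -> U) (x : T) :
    (forall y, D y -> D (f y)) -> D x ->
    (forall y z, D y -> D z -> h y = h z -> y = z) ->
  exists m p, (0 < p)%N /\ iter (m + p) f x = iter m f x.
Proof.
move=> Df Dx injh; have Di n : D (iter n f x) by elim: n => //= n; apply: Df.
pose o (i : 'I_#|U|.+1) := h (iter i f x).
have /injectivePn[i [j ij oij]] : ~~ injectiveb o.
  by apply/injectiveP => /leq_card; rewrite card_ord ltnn.
have fij := injh _ _ (Di i) (Di j) oij.
have [lt|lt|/val_inj eij] := ltngtP i j; last by rewrite eij eqxx in ij.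
  by exists i, (j - i)%N; rewrite subn_gt0 subnKC ?(ltnW lt).
by exists j, (i - j)%N; rewrite subn_gt0 subnKC ?(ltnW lt).
Qed.

Lemma eventually_periodic_iter (R : comNzRingType) (f : R -> R) (A : R) m p :
    (0 < p)%N -> iter (m + p) f A = iter m f A ->
  eventually_periodic (fun i => iter i f A).
Proof.
move=> p0 e; exists m, p; split=> // i mi.
by rewrite -(subnK mi) -addnA [LHS]iterD e -iterD.
Qed.

(** * The degree and the leading coefficient in y *)

Section SizeY.
Variable F : idomainType.
Implicit Types u v : {poly {poly F}}.

Lemma sizeY_polyC (q : {poly F}) : sizeY q%:P = size q.
Proof. by rewrite sizeYE swapXY_polyC size_map_polyC. Qed.

Lemma sizeYD u v : (sizeY (u + v)%R <= maxn (sizeY u) (sizeY v))%N.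
Proof. by rewrite !sizeYE raddfD size_polyD. Qed.

Lemma sizeYN u : sizeY (- u) = sizeY u.
Proof. by rewrite !sizeYE raddfN size_polyN. Qed.

Lemma sizeY_mulXn u n : sizeY (u * 'X^n) = sizeY u.
Proof.
by elim: n => [|n IHn]; rewrite ?expr0 ?mulr1 // exprSr mulrA sizeY_mulX.
Qed.

(** [lead_coef (swapXY u)] is the leading coefficient of [u] in y, a polynomial in x. For nonzero
    [u], its coefficient of index [j] is nonzero exactly when the coefficient of x^j in [u] attains
    the full y-degree. *)
Lemma coef_lead_swapXY u j : (lead_coef (swapXY u))`_j = u`_j`_(sizeY u).-1.
Proof. by rewrite lead_coefE -sizeYE coef_swapXY. Qed.

Lemma sizeY_coef_leq u j :
  (lead_coef (swapXY u))`_j != 0 -> (sizeY u <= size (u`_j)%R)%N.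
Proof.
rewrite coef_lead_swapXY; apply: contraNT; rewrite -ltnNge => lt.
by rewrite nth_default // -ltnS (leq_trans lt) // leqSpred.
Qed.

Lemma sizeY_coef_ltn u j : u != 0 ->
  (lead_coef (swapXY u))`_j = 0 -> (size (u`_j)%R < sizeY u)%N.
Proof.
rewrite -sizeY_eq0 -lt0n coef_lead_swapXY => u0 e.
rewrite -(prednK u0) ltnS; apply/leq_sizeP => i.
rewrite leq_eqVlt => /orP[/eqP <- // | lt]; apply: nth_default.
by apply: leq_trans (max_size_coefXY _ _) _; rewrite -(prednK u0).
Qed.

End SizeY.

(** * The lifted shift on polynomials and its degree bounds *)

Section PolyStep.
Variables (F : fieldType) (P : {poly {poly F}}).
Hypothesis p0_neq0 : P`_0 != 0.
Implicit Types a : {poly {poly F}}.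

(** [drop_poly 1] removes the constant coefficient, which is the remainder of a_0 modulo p_0, and
    divides by x. *)
Definition pstep a := drop_poly 1 (a - (a`_0 %/ P`_0)%:P * P).

Lemma coef_pstep a i :
  (pstep a)`_i = a`_i.+1 - (a`_0 %/ P`_0) * P`_i.+1.
Proof. by rewrite coef_drop_poly addn1 coefB coefCM. Qed.

Lemma pstepE a :
  a = (a`_0 %% P`_0)%:P + (a`_0 %/ P`_0)%:P * P + pstep a * 'X.
Proof.
apply/polyP => -[|i]; rewrite !coefD coefCM coefC coefMX /=.
  by rewrite addr0 addrC -divp_eq.
by rewrite coef_pstep add0r addrC subrK.
Qed.

(** Here [g] is the sum of the first [n] digits times powers of x; each digit is a remainder modulo
    p_0, whence the bound on its y-degree. *)
Lemma pstep_expansion n a : exists g Q,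
  (sizeY g < size (P`_0)%R)%N /\ a = g + Q * P + iter n pstep a * 'X^n.
Proof.
elim: n a => [|n IHn] a.
  exists 0, 0; split; last by rewrite mul0r !add0r expr0 mulr1.
  by rewrite (eqP (_ : sizeY 0 == 0)%N) ?sizeY_eq0 // size_poly_gt0.
have [g [Q [sg e]]] := IHn (pstep a).
exists ((a`_0 %% P`_0)%:P + g * 'X), ((a`_0 %/ P`_0)%:P + Q * 'X); split.
  apply: leq_ltn_trans (sizeYD _ _) _.
  by rewrite gtn_max sizeY_polyC sizeY_mulX sg ltn_modp p0_neq0.
by rewrite {1}(pstepE a) {1}e -iterSr exprSr; ring.
Qed.

(** The y-degree of [g] is too small to affect the top term, so [Q * P] has leading coefficient [c]
    in y, and leading coefficients multiply. *)
Lemma lead_swapXY_dvd (c : {poly F}) g Q :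
    c^:P * ('X^((size (P`_0)%R).-1))%:P = g + Q * P ->
    (sizeY g < size (P`_0)%R)%N ->
  lead_coef (swapXY P) %| c.
Proof.
move=> e sg; have [->|c0] := eqVneq c 0; first exact: dvdp0.
have := congr1 swapXY e.
rewrite rmorphM rmorphD rmorphM /= swapXY_map_polyC swapXY_polyC map_polyXn.
move/eqP; rewrite addrC -subr_eq => /eqP/(congr1 lead_coef).
rewrite lead_coefDl ?lead_coefM ?lead_coefC ?lead_coefXn ?mulr1.
  by move=> ->; exact: dvdp_mull.
rewrite size_polyN -sizeYE size_Cmul ?size_polyXn //.
by rewrite prednK // size_poly_gt0.
Qed.

Lemma size_divp_mul (a q : {poly F}) :
  (size (a %/ P`_0 * q)%R <= size a + size q - size (P`_0)%R)%N.
Proof.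
have s0 : (0 < size (P`_0)%R)%N by rewrite size_poly_gt0.
(* A nonzero quotient forces [size a] to be at least the size of p_0, so the truncated subtractions
   below are exact. *)
have [->|q0] := eqVneq (a %/ P`_0) 0; first by rewrite mul0r size_poly0.
have := size_polyMleq (a %/ P`_0) q; move: q0.
rewrite -size_poly_gt0 size_divp //.
move: s0; move: (size a) (size q) (size P`_0) (size (a %/ P`_0 * q)) => *; lia.
Qed.

Lemma size_pstep a k :
  (size P <= k.+1)%N -> (size a <= k)%N -> (size (pstep a) <= k)%N.
Proof.
move=> sP sa; rewrite size_drop_poly leq_subLR add1n.
apply: leq_trans (size_polyD _ _) _; rewrite geq_max size_polyN (leqW sa).
by rewrite mul_polyC (leq_trans (size_scale_leq _ _)).
Qed.

Lemma size_coef_pstep a i M :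
    (size (a`_i.+1)%R <= M)%N ->
    (size (a`_0)%R + size (P`_i.+1)%R - size (P`_0)%R <= M)%N ->
  (size ((pstep a)`_i)%R <= M)%N.
Proof.
move=> sa sq; rewrite coef_pstep; apply: leq_trans (size_polyD _ _) _.
by rewrite geq_max size_polyN sa (leq_trans (size_divp_mul _ _)).
Qed.

(* The entries of index at least [k - j] have already lost one degree in [y]
   after [j] steps. *)
Lemma iter_pstep_lower a k M :
    (forall i, (size (P`_i.+1)%R < size (P`_0)%R)%N) -> (size P <= k.+1)%N ->
    (size a <= k)%N -> (forall i, (size (a`_i)%R <= M.+1)%N) ->
  forall j, [/\ (size (iter j pstep a) <= k)%N,
    forall i, (size ((iter j pstep a)`_i)%R <= M.+1)%N &
    forall i, (k <= i + j)%N -> (size ((iter j pstep a)`_i)%R <= M)%N].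
Proof.
move=> ltP sP sa ca; elim=> [|j [IHs IHc IHl]] /=.
  split=> // i; rewrite addn0 => ki.
  by rewrite nth_default ?size_poly0 // (leq_trans sa).
split=> [|i|i ki]; first exact: size_pstep.
  by apply: size_coef_pstep => //; have := IHc 0%N; have := ltP i; lia.
(* Entry [i] inherits entry [i.+1] of the previous step, already lowered; the strict inequality puts
   the subtracted multiple of p_(i+1) one degree below the bound [M.+1] for the constant entry. *)
apply: size_coef_pstep; first by apply: IHl; rewrite addSnnS.
by have := IHc 0%N; have := ltP i; lia.
Qed.

Lemma iter_pstep_eq0 a :
  (forall i, (size (P`_i.+1)%R < size (P`_0)%R)%N) ->
  exists n, iter n pstep a = 0.
Proof.
move=> ltP; pose k := maxn (size a) (size P).
have sP : (size P <= k.+1)%N by rewrite leqW // leq_maxr.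
have sa : (size a <= k)%N by rewrite leq_maxl.
have ca := max_size_coefXY a.
(* The bound [k] on the x-size is kept by all iterates, so it stays fixed in the induction on [M];
   each block of [k] steps lowers every coefficient. *)
move: (sizeY a) ca => M; move: k sP sa => k sP.
elim: M a => [|M IHM] a sa ca.
  exists 0%N; apply/polyP => i; apply/eqP.
  by rewrite coef0 -size_poly_leq0 ca.
have [sb _ cb] := iter_pstep_lower ltP sP sa ca k.
have [i|n en] := IHM _ sb; first by apply: cb; rewrite leq_addl.
by exists (n + k)%N; rewrite iterD.
Qed.

End PolyStep.

(** * Periodicity of the lifted shift over a finite field *)

Section FiniteBox.
Variables (F : finFieldType) (P : {poly {poly F}}).
Hypothesis p0_neq0 : P`_0 != 0.

Lemma iter_pstep_periodic (a : {poly {poly F}}) :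
    (forall i, (size (P`_i.+1)%R <= size (P`_0)%R)%N) ->
  exists m p, (0 < p)%N /\ iter (m + p) (pstep P) a = iter m (pstep P) a.
Proof.
move=> leP; pose k := maxn (size a) (size P); pose M := sizeY a.
pose D (b : {poly {poly F}}) :=
  (size b <= k)%N /\ forall i, (size (b`_i)%R <= M)%N.
(* On [D] all coefficients outside the [k] by [M] box vanish, so this matrix over a finite field
   determines [b]. *)
pose h (b : {poly {poly F}}) : 'M[F]_(k, M) := \matrix_(i, j) b`_i`_j.
apply: (iter_pigeonhole (D := D) (h := h)).
- move=> b [sb cb]; split; first by rewrite size_pstep // leqW // leq_maxr.
  by move=> i; apply: size_coef_pstep; rewrite // leq_subLR addnC leq_add.
- by split; [rewrite leq_maxl | exact: max_size_coefXY].
- move=> b c [sb cb] [sc cc] /matrixP e; apply/polyP => i; apply/polyP => j.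
  have [ki|ik] := leqP k i.
    by rewrite [b`_i]nth_default ?[c`_i]nth_default ?(leq_trans _ ki).
  have [Mj|jM] := leqP M j.
    by rewrite [LHS]nth_default ?[RHS]nth_default ?(leq_trans _ Mj).
  by have := e (Ordinal ik) (Ordinal jM); rewrite !mxE.
Qed.

End FiniteBox.

(** * Transfer to the quotient ring and the two equivalences *)

Section QuotientShift.
Variables (F : finFieldType) (d : nat) (P : {poly {poly F}}).
Hypotheses (d_ge1 : (1 <= d)%N) (sizeP : size P = d.+1) (p0_neq0 : P`_0 != 0).

Local Notation X := (quotX d_ge1 sizeP).
Local Notation N := (quotN d_ge1 sizeP).
Local Notation pi := (quotR_pi d_ge1 sizeP).
Local Notation T := (shift X N).

Lemma quotR_pi_eq0 a : pi a = 0 <-> exists Q, a = Q * P.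
Proof.
have -> : 0 = pi 0 by rewrite -[in RHS](subrr 0) quotR_piB subrr.
by rewrite quotR_piE subr0.
Qed.

(** [pstepE] exhibits a digit and a quotient by [X]; uniqueness of digits and injectivity of
    multiplication by [X] identify them with the chosen ones. *)
Lemma shift_pi a : T (pi a) = pi (pstep P a).
Proof.
have e : pi a - pi (a`_0 %% P`_0)%:P = X * pi (pstep P a).
  rewrite -quotR_piB -quotR_piM; apply/quotR_piE; exists (a`_0 %/ P`_0)%:P.
  by rewrite {1}(pstepE P a); ring.
have Dr : digit_spec X N (pi a) (pi (a`_0 %% P`_0)%:P).
  split; last by exists (pi (pstep P a)).
  by exists (a`_0 %% P`_0) => //=; rewrite ltn_modp.
have De : digit X N (pi a) = pi (a`_0 %% P`_0)%:P.
  by apply: (xget_unique _ Dr) => y Dy; exact: (digit_uniq Dy Dr).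
apply: xget_unique => [|y] /=; rewrite De e // => ey.
exact: (mulX_inj p0_neq0 ey).
Qed.

Lemma iter_shift_pi n a : iter n T (pi a) = pi (iter n (pstep P) a).
Proof. by elim: n => //= n ->; rewrite shift_pi. Qed.

(** Extends the bound to indices beyond [d], as the iteration lemmas quantify over all
    coefficients. *)
Let size_coefP i : (0 < i)%N ->
  (size (P`_i)%R <= \max_(1 <= i < d.+1) size (P`_i)%R)%N.
Proof.
move=> i0; have [di|id] := leqP d.+1 i.
  by rewrite nth_default ?sizeP // size_poly0.
by have /bigmax_nat_leqP-> := leqnn (\max_(1 <= i < d.+1) size (P`_i)%R);
  rewrite ?i0.
Qed.

Let P_neq0 : P != 0.
Proof. by rewrite -size_poly_gt0 sizeP. Qed.

Lemma finite_expansion_iff : finite_expansion X N <->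
  (\max_(1 <= i < d.+1) size (P`_i)%R < size (P`_0)%R)%N.
Proof.
split=> [fin|lt A]; last first.
  have [a ->] := quotR_piK A.
  have [|n en] := @iter_pstep_eq0 _ _ p0_neq0 a.
    by move=> i; apply: leq_ltn_trans lt; apply: size_coefP.
  exists n; rewrite iter_shift_pi en; apply/quotR_pi_eq0.
  by exists 0; rewrite mul0r.
pose a : {poly {poly F}} := ('X^((size (P`_0)%R).-1))%:P.
have [n] := fin (pi a); rewrite iter_shift_pi => /quotR_pi_eq0[R eR].
have [g [Q [sg]]] := pstep_expansion p0_neq0 n a; rewrite eR => ea.
(* The final iterate is [R * P], so its contribution is absorbed into the cofactor of [P]. *)
have : lead_coef (swapXY P) %| 1.
  apply: (lead_swapXY_dvd p0_neq0 (g := g) (Q := Q + R * 'X^n)) => //.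
  by rewrite rmorph1 mul1r -/a {1}ea; ring.
rewrite dvdp1 => /size_poly1P[c c0 ec].
have le0 : (sizeY P <= size (P`_0)%R)%N.
  by apply: sizeY_coef_leq; rewrite ec coefC.
rewrite -(prednK (_ : 0 < size (P`_0)%R)%N) ?size_poly_gt0 // ltnS.
apply/bigmax_nat_leqP => i /andP[i1 _].
rewrite -ltnS prednK ?size_poly_gt0 //; apply: leq_trans le0.
by apply: sizeY_coef_ltn => //; rewrite ec coefC; case: i i1.
Qed.

Lemma periodic_expansion_iff : periodic_expansion X N <->
  (\max_(1 <= i < d.+1) size (P`_i)%R <= size (P`_0)%R)%N.
Proof.
split=> [per|le A]; last first.
  have [a ->] := quotR_piK A.
  have [|m [p [p0 e]]] := @iter_pstep_periodic _ _ p0_neq0 a.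
    by move=> i; apply: leq_trans le; apply: size_coefP.
  by apply: (eventually_periodic_iter (m := m) p0); rewrite !iter_shift_pi e.
pose a : {poly {poly F}} := ('X^((size (P`_0)%R).-1))%:P.
have [m [p [p0 /(_ m (leqnn m))]]] := per (pi a).
rewrite !iter_shift_pi addnC iterD => /quotR_piE.
have [g1 [Q1 [sg1]]] := pstep_expansion p0_neq0 m a.
have [g2 [Q2 [sg2]]] := pstep_expansion p0_neq0 p (iter m (pstep P) a).
set b := iter m _ a; set b' := iter p _ b => eb ea [Q3 e3].
have {}e3 : b' = b + Q3 * P by rewrite -e3 addrC subrK.
(* Combining [eb] with [e3] writes [(1 - 'X^p) * b] as [g2] plus a multiple of [P]; substituting
   this into [1 - 'X^p] times [ea] gives the two witnesses. *)
have dv : lead_coef (swapXY P) %| 1 - 'X^p.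
  apply: (lead_swapXY_dvd p0_neq0
    (g := g1 - g1 * 'X^p + g2 * 'X^m)
    (Q := (1 - 'X^p) * Q1 + 'X^m * (Q2 + Q3 * 'X^p))).
    have ebp : (1 - 'X^p) * b = g2 + (Q2 + Q3 * 'X^p) * P.
      by rewrite mulrBl mul1r {1}eb e3; ring.
    rewrite rmorphB rmorph1 /= map_polyXn -/a {1}ea.
    transitivity ((1 - 'X^p) * (g1 + Q1 * P) + 'X^m * ((1 - 'X^p) * b)).
      by ring.
    by rewrite ebp; ring.
  apply: leq_ltn_trans (sizeYD _ _) _; rewrite gtn_max.
  rewrite sizeY_mulXn sg2 andbT.
  apply: leq_ltn_trans (sizeYD _ _) _.
  by rewrite gtn_max sizeYN sizeY_mulXn sg1.
(* A zero constant term in the divisor would pass to [1 - 'X^p], whose constant term is 1 because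
   [p] is positive. *)
have le0 : (sizeY P <= size (P`_0)%R)%N.
  apply: sizeY_coef_leq; apply/eqP => l0; move/dvdpP: dv => [c].
  move/(congr1 (fun q : {poly F} => q`_0)).
  rewrite coef0M l0 mulr0 coefB coef1 coefXn; case: (p) p0 => // p' _ /eqP.
  by rewrite subr0 oner_eq0.
apply/bigmax_nat_leqP => i _; exact: leq_trans (max_size_coefXY _ _) le0.
Qed.

End QuotientShift.

Theorem theorem5p8 (F : finFieldType) (d : nat) (P : {poly {poly F}})
    (d_ge1 : (1 <= d)%N) (sizeP : size P = d.+1) (p0_neq0 : P`_0 != 0) :
  (finite_expansion (quotX d_ge1 sizeP) (quotN d_ge1 sizeP) <->
     (\max_(1 <= i < d.+1) size (P`_i)%R < size (P`_0)%R)%N)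
  /\
  (periodic_expansion (quotX d_ge1 sizeP) (quotN d_ge1 sizeP) <->
     (\max_(1 <= i < d.+1) size (P`_i)%R <= size (P`_0)%R)%N).
Proof.
by split; [exact: finite_expansion_iff | exact: periodic_expansion_iff].
Qed.
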